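(* Let $d,q,m\ge 1$ be integers, let $z\in\mathbb{R}^d$, let $Y=\{y_1,\ldots,y_m\}\subset\mathbb{R}^d$ be a set of $m$ distinct points with $z\notin\{y_2,\ldots,y_m\}$ (the case $z=y_1$ is allowed), and let $D$ be a linear differential operator $Du=\sum_{\alpha\in\mathbb{Z}_+^d,\,|\alpha|\le\kappa}c_\alpha\,\partial^\alpha u$ with real (variable) coefficients $c_\alpha$. Assume that $\rho_{q,D}(z,Y)<\infty$. Let the weight vector $w^\circ\in\mathbb{R}^m$, the subset $Y^\circ\subset Y$ and the matrices $R_1,R_2$ be obtained from $Y$ by the pivoted QR construction described in the context, and let $w^{**}\in\mathbb{R}^m$ be the $\ell_2$-minimal weight vector, i.e. the vector minimizing $\|w\|_{2,q}$ over all $w\in\mathbb{R}^m$ satisfying the exactness condition $Dp(z)=\sum_{j=1}^m w_jp(y_j)$ for all $p\in\Pi^d_q$. Then $$\|w^\circ\|_{2,q}\le \big(1+\|R_1^{-1}R_2\|_2^2\big)^{1/2}\,\|w^{**}\|_{2,q},$$ $$\rho_{q,D}(z,Y^\circ)\le n^{1/2}\big(1+\|R_1^{-1}R_2\|_2^2\big)^{1/2}\rho_{q,D}(z,Y),$$ where $n=|Y^\circ|\le r_q(Y)$ is the number of nonzero components of $w^\circ$.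
   Context: **Notation.** $\Pi^d_q$ is the space of real $d$-variate polynomials of order at most $q$, i.e. of total degree less than $q$; $\nu:=\dim\Pi^d_q=\binom{q-1+d}{d}$. For a finite set $X\subset\mathbb{R}^d$ the growth function is $$\rho_{q,D}(z,X)=\sup\{Dp(z):\ p\in\Pi^d_q,\ |p(x)|\le\|x-z\|_2^{q}\ \text{for all } x\in X\}\in[0,\infty].$$ For $w\in\mathbb{R}^m$ (weights attached to $y_1,\ldots,y_m$), $\|w\|_{2,q}:=\big(\sum_{j=1}^m w_j^2\|y_j-z\|_2^{2q}\big)^{1/2}$. For matrices, $\|\cdot\|_2$ is the spectral norm (and an empty matrix has norm $0$). Let $p_1,\ldots,p_\nu$ be a basis of $\Pi^d_q$; in the case $z=y_1$ it is required that $p_1\equiv1$ and $p_2(z)=\cdots=p_\nu(z)=0$. Put $$A:=[p_i(y_j)]_{i=1,\ldots,\nu;\ j=1,\ldots,m}\in\mathbb{R}^{\nu\times m},\qquad b:=[Dp_i(z)]_{i=1}^{\nu}\in\mathbb{R}^\nu.$$ The exactness condition is equivalent to $Aw=b$. This system is consistent if and only if $\rho_{q,D}(z,Y)<\infty$ (known fact). The rank of $A$ does not depend on the basis and is denoted $r_q(Y)$. **Construction, case $z\ne y_1$.** Let $\Theta:=\mathrm{diag}(\theta_1,\ldots,\theta_m)$, $\theta_j=\|y_j-z\|_2^{-q}$, and $\tilde A:=A\Theta$, so that $Aw=b$ is equivalent to $\tilde Av=b$ with $w=\Theta v$. Compute a QR factorization of $\tilde A$ with column pivoting, $$\tilde AP=Q\begin{bmatrix}A_1&A_2\\0&0\end{bmatrix},$$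 where $P$ is a permutation matrix, $Q$ is an orthogonal matrix, and $A_1\in\mathbb{R}^{r\times r}$ is upper triangular and nonsingular with $r=\mathrm{rank}(\tilde A)$. Let $s$ be the largest index of a nonzero component of $Q^Tb$ ($s=0$ if $b=0$), so that $Q^Tb=\begin{bmatrix}\tilde b\\0\end{bmatrix}$ with $\tilde b\in\mathbb{R}^s$; consistency gives $s\le r$. Repartition $$\tilde AP=Q\begin{bmatrix}R_1&R_2\\0&T\end{bmatrix},\qquad R_1\in\mathbb{R}^{s\times s},$$ where $R_1$ is upper triangular and nonsingular and $R_2$ has $s$ rows and consists of the remaining columns. Let $\tilde v^\circ\in\mathbb{R}^m$ be defined by $R_1[\tilde v^\circ_i]_{i=1}^s=\tilde b$ and $\tilde v^\circ_i=0$ for $i=s+1,\ldots,m$. Set $w^\circ:=\Theta P\tilde v^\circ$, which satisfies $Aw^\circ=b$. **Construction, case $z=y_1$.** Let $c_0$ be the coefficient of $D$ for $\alpha=0$, so that $Dp_1(z)=c_0(z)$. Let $A':=[p_i(y_j)]_{i=2,\ldots,\nu;\ j=2,\ldots,m}$, $b':=[Dp_i(z)]_{i=2}^\nu$, $\Theta:=\mathrm{diag}(\theta_2,\ldots,\theta_m)$ with $\theta_j=\|y_j-z\|_2^{-q}$, and $\tilde A:=A'\Theta$. Compute, exactly as in the first case, a pivoted QR factorization of this $\tilde A$, with $b$ replaced by $b'$: $s$ is the largest index of a nonzero component of $Q^Tb'$ ($s=0$ if $b'=0$), $Q^Tb'=\begin{bmatrix}\tilde b\\0\end{bmatrix}$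 with $\tilde b\in\mathbb{R}^s$, $\tilde AP=Q\begin{bmatrix}R_1&R_2\\0&T\end{bmatrix}$ with $R_1\in\mathbb{R}^{s\times s}$ upper triangular and nonsingular, and $\tilde v^\circ\in\mathbb{R}^{m-1}$ has its first $s$ components given by $R_1^{-1}\tilde b$ and the others equal to zero. Set $\tilde w=[\tilde w_j]_{j=2}^m:=\Theta P\tilde v^\circ\in\mathbb{R}^{m-1}$ and $$w^\circ:=\begin{bmatrix}c_0(z)-\sum_{j=2}^m\tilde w_j\\ \tilde w\end{bmatrix}\in\mathbb{R}^m,$$ which satisfies $Aw^\circ=b$. **In both cases**, $Y^\circ:=\{y_j:\ w^\circ_j\ne0\}\subset Y$. *)

(* Defs.v *)
(* mpoly has to be imported before the analysis files: the notations clash in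
   the other order. *)
From HB Require Import structures.
From mathcomp Require Import all_boot all_order all_fingroup all_algebra.
From mathcomp Require Import mpoly.
From mathcomp Require Import all_classical all_reals all_analysis.

Set Implicit Arguments.
Unset Strict Implicit.
Unset Printing Implicit Defensive.

Import Order.TTheory GRing.Theory Num.Theory.

Local Open Scope classical_set_scope.
Local Open Scope ring_scope.

(* The MathComp-Analysis norm on matrices is the max norm, hence this one. *)
Definition norm2 (R : realType) (n : nat) (x : 'cV[R]_n) : R :=
  Num.sqrt (\sum_(i < n) x i 0 ^+ 2).

(* Operator norm induced by norm2; it is 0 when M has no row or no column. *)
Definition spectral_norm (R : realType) (k l : nat) (M : 'M[R]_(k, l)) : R :=
  sup [set norm2 (M *m x) | x in [set x : 'cV[R]_l | norm2 x <= 1]].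

Definition peval (R : realType) (d : nat) (p : {mpoly R[d]}) (x : 'cV[R]_d) :
    R :=
  p.@[fun i => x i 0].

(* Order at most q means total degree < q; msize is 1 + total degree. *)
Definition Pi (R : realType) (d q : nat) : set {mpoly R[d]} :=
  [set p | (msize p <= q)%N].

Definition is_basis_Pi (R : realType) (d q n : nat)
    (p : 'I_n -> {mpoly R[d]}) : Prop :=
  [/\ forall i, Pi q (p i),
      forall a : 'I_n -> R, \sum_i a i *: p i = 0 -> forall i, a i = 0 &
      forall f, Pi q f -> exists a : 'I_n -> R, f = \sum_i a i *: p i].

(* (D f)(x) for D = \sum_(|alpha| <= kappa) c_alpha d^alpha. *)
Definition diffop (R : realType) (d kappa : nat)
    (c : 'X_{1..d} -> 'cV[R]_d -> R) (f : {mpoly R[d]}) (x : 'cV[R]_d) : R :=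
  \sum_(alpha : 'X_{1..d < kappa.+1}) c alpha x * peval f^`M[alpha] x.

Definition growth (R : realType) (d q kappa : nat)
    (c : 'X_{1..d} -> 'cV[R]_d -> R) (z : 'cV[R]_d) (X : set 'cV[R]_d) :
    \bar R :=
  ereal_sup [set (diffop kappa c p z)%:E | p in
    [set p | Pi q p /\ forall x, X x -> `|peval p x| <= norm2 (x - z) ^+ q]].

Definition wnorm (R : realType) (d q m : nat) (z : 'cV[R]_d)
    (y : 'I_m -> 'cV[R]_d) (w : 'cV[R]_m) : R :=
  Num.sqrt (\sum_(j < m) w j 0 ^+ 2 * norm2 (y j - z) ^+ (2 * q)).

Definition exact_weights (R : realType) (d q kappa m : nat)
    (c : 'X_{1..d} -> 'cV[R]_d -> R) (z : 'cV[R]_d) (y : 'I_m -> 'cV[R]_d)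
    (w : 'cV[R]_m) : Prop :=
  forall p, Pi q p -> diffop kappa c p z = \sum_(j < m) w j 0 * peval p (y j).

Definition l2_minimal (R : realType) (d q kappa m : nat)
    (c : 'X_{1..d} -> 'cV[R]_d -> R) (z : 'cV[R]_d) (y : 'I_m -> 'cV[R]_d)
    (w : 'cV[R]_m) : Prop :=
  exact_weights q kappa c z y w /\
  forall w' : 'cV[R]_m, exact_weights q kappa c z y w' ->
    wnorm q z y w <= wnorm q z y w'.

Definition colloc (R : realType) (d n m : nat) (p : 'I_n -> {mpoly R[d]})
    (y : 'I_m -> 'cV[R]_d) : 'M[R]_(n, m) :=
  \matrix_(i < n, j < m) peval (p i) (y j).

Definition rhs (R : realType) (d kappa n : nat)
    (c : 'X_{1..d} -> 'cV[R]_d -> R) (z : 'cV[R]_d)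
    (p : 'I_n -> {mpoly R[d]}) : 'cV[R]_n :=
  \col_(i < n) diffop kappa c (p i) z.

Definition Theta (R : realType) (d q m : nat) (z : 'cV[R]_d)
    (y : 'I_m -> 'cV[R]_d) : 'M[R]_m :=
  diag_mx (\row_(j < m) norm2 (y j - z) ^- q).

(* pivoted_qr A b R1 R2 v: for some QR factorization with column pivoting
     A P = Q [A1 A2; 0 0] = Q [R1 R2; 0 T],   P := perm_mx sigma,
   v = P [vs; 0] where R1 vs = bt and Q^T b = [bt; 0].  The casts only
   identify the block dimensions with those of A.  is_trig_mx means lower
   triangular, whence the transposes; the \max is the 1-based index of the
   last nonzero component of Q^T b, and 0 if there is none. *)
Variant pivoted_qr (R : realType) (k l : nat) (A : 'M[R]_(k, l))
    (b : 'cV[R]_k) (s l2 : nat) (R1 : 'M[R]_s) (R2 : 'M[R]_(s, l2))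
    (v : 'cV[R]_l) : Prop :=
  PivotedQR (sigma : 'S_l) (Q : 'M[R]_k)
    (r k1 l1 : nat) (A1 : 'M[R]_r) (A2 : 'M[R]_(r, l1))
    (ek1 : (r + k1 = k)%N) (el1 : (r + l1 = l)%N)
    (k2 : nat) (T : 'M[R]_(k2, l2)) (bt vs : 'cV[R]_s)
    (ek2 : (s + k2 = k)%N) (el2 : (s + l2 = l)%N) of
    Q^T *m Q = 1%:M
  & r = \rank A
  & is_trig_mx A1^T
  & A1 \in unitmx
  & A *m perm_mx sigma = Q *m castmx (ek1, el1) (block_mx A1 A2 0 0)
  & s = \max_(i < k | (Q^T *m b) i 0 != 0) i.+1
  & Q^T *m b = castmx (ek2, erefl) (col_mx bt 0)
  & is_trig_mx R1^T
  & R1 \in unitmx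
  & A *m perm_mx sigma = Q *m castmx (ek2, el2) (block_mx R1 R2 0 T)
  & R1 *m vs = bt
  & v = perm_mx sigma *m castmx (el2, erefl) (col_mx vs 0).

(* w is a weight vector w° produced by the construction, with blocks R1, R2.
   The first point is y ord0; the remaining points (and, when z = y ord0, the
   remaining basis polynomials) are indexed through lift ord0. *)
Variant qr_weights (R : realType) (d q kappa m nu : nat)
    (c : 'X_{1..d} -> 'cV[R]_d -> R) (z : 'cV[R]_d)
    (y : 'I_m.+1 -> 'cV[R]_d) (p : 'I_nu.+1 -> {mpoly R[d]}) (s l2 : nat)
    (R1 : 'M[R]_s) (R2 : 'M[R]_(s, l2)) (w : 'cV[R]_m.+1) : Prop :=
| QRWeightsNeq (v : 'cV[R]_m.+1) of
    z != y ord0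
  & pivoted_qr (colloc p y *m Theta q z y) (rhs kappa c z p) R1 R2 v
  & w = Theta q z y *m v
| QRWeightsEq (v : 'cV[R]_m) (wt : 'cV[R]_m) of
    z = y ord0
  & pivoted_qr
      (colloc (p \o lift ord0) (y \o lift ord0) *m Theta q z (y \o lift ord0))
      (rhs kappa c z (p \o lift ord0)) R1 R2 v
  & wt = Theta q z (y \o lift ord0) *m v
  & w = col_mx (c 0%MM z - \sum_(j < m) wt j 0)%:M wt.

(* Main.v *)
Require Import Defs.
From HB Require Import structures.
From mathcomp Require Import all_boot all_order all_fingroup all_algebra.
From mathcomp Require Import mpoly.
From mathcomp Require Import all_classical all_reals all_analysis.
From mathcomp Require Import ring.

(** The construction and the optimal weights are compared through the scaled
    unknown [v], [w = Theta v], in which the weighted norm of [w] is the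
    Euclidean norm of [v] and exactness becomes [A v = b] for the scaled
    collocation matrix [A].  If [z] is itself the first point, its weight has no
    influence on the weighted norm; on the polynomials vanishing at [z],
    exactness is then a system of the same form over the other points, and the
    equation for the constant polynomial only determines the first weight.

    Near-optimality ([pivoted_qr_near_minimal]).  Let [A v' = b] and let
    [x1, x2] be the two blocks of the permuted [v'].  The first [s] rows of the
    factorized system give [R1 x1 + R2 x2 = bt], so the basic solution
    [R1^-1 bt] equals [x1 + R1^-1 R2 x2].  Its norm is at most
    [|x1| + S |x2| <= sqrt (1 + S^2) |v'|], where [S] is the spectral norm of
    [R1^-1 R2].

    Growth functions.  For exact weights [w], any polynomial [f] admissible on
    the support of [w] satisfies [D f(z) <= sum_j |w_j| |y_j - z|^q], and the
    Cauchy-Schwarz inequality on the [n] nonzero terms bounds this by [sqrt n]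
    times the weighted norm of [w] ([growth_le_wnorm]).  Conversely the growth
    function on all points is at least the minimal weighted norm
    ([min_norm_le_growth]): the minimal-norm solution has the form
    [v' = A^T u], and the coefficients [u] define a polynomial [f] with
    [f(y_j) = v'_j |y_j - z|^q] and [D f(z) = b^T u = |v'|^2].  Then
    [f / |v'|] is admissible and [D] maps it to [|v'|] at [z].  Chaining the
    three bounds gives the second inequality.

    Support ([pivoted_qr_support]).  The basic solution has at most [s] nonzero
    entries, and [s <= rank A] because [R1] is an invertible block of [A] up to
    multiplication by matrices.  If [z] is the first point, its weight may be
    one more nonzero entry, and the collocation matrix has rank one more than
    the reduced one ([rank_border]). *)

Set Implicit Arguments.
Unset Strict Implicit.
Unset Printing Implicit Defensive.

Import Order.TTheory GRing.Theory Num.Theory.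

Local Open Scope classical_set_scope.
Local Open Scope ring_scope.

(** * Euclidean and spectral norms *)

(** Lagrange's identity writes the difference of the two sides, doubled, as a
    sum of squares. *)
Lemma cauchy_schwarz_sum (R : realDomainType) (I : finType) (a b : I -> R) :
  (\sum_i a i * b i) ^+ 2 <= (\sum_i a i ^+ 2) * (\sum_i b i ^+ 2).
Proof.
have lagrange : \sum_i \sum_j (a i * b j - a j * b i) ^+ 2 =
    ((\sum_i a i ^+ 2) * (\sum_i b i ^+ 2) - (\sum_i a i * b i) ^+ 2) *+ 2.
  have sumM (f g : I -> R) :
      (\sum_i f i) * (\sum_j g j) = \sum_i \sum_j f i * g j.
    by rewrite big_distrlr.
  rewrite mulrnBl expr2 mulr2n {2}mulrC !sumM -big_split /= mulr2n.
  rewrite -!big_split -sumrB.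
  apply: eq_bigr => i _; rewrite -!big_split -sumrB /=.
  by apply: eq_bigr => j _; ring.
rewrite -subr_ge0 -(pmulrn_lge0 _ (ltn0Sn 1)) -lagrange.
by do 2![apply: sumr_ge0 => ? _]; exact: sqr_ge0.
Qed.

Lemma norm2_ge0 (R : realType) n (x : 'cV[R]_n) : 0 <= norm2 x.
Proof. exact: sqrtr_ge0. Qed.

Lemma sqr_norm2 (R : realType) n (x : 'cV[R]_n) :
  norm2 x ^+ 2 = \sum_i x i 0 ^+ 2.
Proof. by rewrite sqr_sqrtr // sumr_ge0 // => i _; rewrite sqr_ge0. Qed.

Lemma sqr_norm2_mulmx (R : realType) n (x : 'cV[R]_n) :
  norm2 x ^+ 2 = (x^T *m x) 0 0.
Proof.
by rewrite sqr_norm2 mxE; apply: eq_bigr => j _; rewrite mxE expr2.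
Qed.

Lemma norm2_eq0 (R : realType) n (x : 'cV[R]_n) : (norm2 x == 0) = (x == 0).
Proof.
apply/idP/eqP => [|->]; last first.
  by rewrite -sqrf_eq0 sqr_norm2 big1 // => i _; rewrite mxE expr0n.
rewrite -sqrf_eq0 sqr_norm2 psumr_eq0; last by move=> i _; rewrite sqr_ge0.
move=> /allP x0; apply/colP => i; rewrite mxE; apply/eqP.
by rewrite -sqrf_eq0 (implyP (x0 i (mem_index_enum i))).
Qed.

Lemma norm20 (R : realType) n : norm2 (0 : 'cV[R]_n) = 0.
Proof. by apply/eqP; rewrite norm2_eq0. Qed.

Lemma norm2_gt0 (R : realType) n (x : 'cV[R]_n) : (0 < norm2 x) = (x != 0).
Proof. by rewrite lt0r norm2_eq0 norm2_ge0 andbT. Qed.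

Lemma norm2_le (R : realType) n (x : 'cV[R]_n) (t : R) :
  0 <= t -> \sum_i x i 0 ^+ 2 <= t ^+ 2 -> norm2 x <= t.
Proof.
by move=> t0; rewrite -sqr_norm2 ler_sqr ?nnegrE ?norm2_ge0.
Qed.

Lemma norm2Z (R : realType) n (k : R) (x : 'cV[R]_n) :
  norm2 (k *: x) = `|k| * norm2 x.
Proof.
rewrite /norm2 -sqrtr_sqr -sqrtrM ?sqr_ge0 //; congr Num.sqrt.
by rewrite mulr_sumr; apply: eq_bigr => i _; rewrite mxE exprMn.
Qed.

Lemma norm2D (R : realType) n (x y : 'cV[R]_n) :
  norm2 (x + y) <= norm2 x + norm2 y.
Proof.
apply: norm2_le; first by rewrite addr_ge0 ?norm2_ge0.
have -> : \sum_i (x + y) i 0 ^+ 2 =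
    norm2 x ^+ 2 + norm2 y ^+ 2 + (\sum_i x i 0 * y i 0) *+ 2.
  rewrite !sqr_norm2 mulr2n -!big_split /=.
  by apply: eq_bigr => i _; rewrite mxE; ring.
rewrite sqrrD addrAC lerD2r lerD2l lerMn2r /=.
apply: le_trans (ler_norm _) _.
rewrite -ler_sqr ?nnegrE ?mulr_ge0 ?norm2_ge0 ?normr_ge0 //.
by rewrite real_normK ?num_real // exprMn !sqr_norm2 cauchy_schwarz_sum.
Qed.

Lemma sqr_norm2_col_mx (R : realType) k l (x : 'cV[R]_k) (y : 'cV[R]_l) :
  norm2 (col_mx x y) ^+ 2 = norm2 x ^+ 2 + norm2 y ^+ 2.
Proof.
rewrite !sqr_norm2 big_split_ord /=.
by congr (_ + _); apply: eq_bigr => i _; rewrite ?col_mxEu ?col_mxEd.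
Qed.

Lemma norm2_perm_mx (R : realType) n (s : 'S_n) (x : 'cV[R]_n) :
  norm2 (perm_mx s *m x) = norm2 x.
Proof.
rewrite -row_permE /norm2; congr Num.sqrt.
rewrite [RHS](reindex_inj (@perm_inj _ s)).
by apply: eq_bigr => i _; rewrite mxE.
Qed.

Lemma entry_le_norm2 (R : realType) n (x : 'cV[R]_n) i : `|x i 0| <= norm2 x.
Proof.
rewrite -ler_sqr ?nnegrE ?norm2_ge0 // real_normK ?num_real // sqr_norm2.
by rewrite (bigD1 i) //= lerDl sumr_ge0 // => j _; rewrite sqr_ge0.
Qed.

(** The Frobenius norm is a crude bound, used only to show that the supremum
    defining the spectral norm is finite. *)
Lemma norm2_mulmx_le (R : realType) k l (M : 'M[R]_(k, l)) (x : 'cV[R]_l) :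
  norm2 (M *m x) <= Num.sqrt (\sum_i \sum_j M i j ^+ 2) * norm2 x.
Proof.
have M0 : 0 <= \sum_i \sum_j M i j ^+ 2.
  by do 2![apply: sumr_ge0 => ? _]; exact: sqr_ge0.
apply: norm2_le; first by rewrite mulr_ge0 ?sqrtr_ge0 ?norm2_ge0.
rewrite exprMn sqr_sqrtr // sqr_norm2 mulr_suml; apply: ler_sum => i _.
by rewrite mxE; exact: cauchy_schwarz_sum.
Qed.

Lemma spectral_norm_ge (R : realType) k l (M : 'M[R]_(k, l)) (x : 'cV[R]_l) :
  norm2 x <= 1 -> norm2 (M *m x) <= spectral_norm M.
Proof.
move=> x1; apply: ub_le_sup; last by exists x.
exists (Num.sqrt (\sum_i \sum_j M i j ^+ 2)) => _ [u /= u1 <-].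
apply: le_trans (norm2_mulmx_le _ _) _.
by rewrite ler_piMr ?sqrtr_ge0.
Qed.

Lemma spectral_norm_ge0 (R : realType) k l (M : 'M[R]_(k, l)) :
  0 <= spectral_norm M.
Proof.
have := @spectral_norm_ge R k l M 0.
by rewrite mulmx0 !norm20 ler01 => /(_ isT).
Qed.

Lemma spectral_normP (R : realType) k l (M : 'M[R]_(k, l)) (x : 'cV[R]_l) :
  norm2 (M *m x) <= spectral_norm M * norm2 x.
Proof.
have [->|x0] := eqVneq x 0.
  by rewrite mulmx0 !norm20 mulr0.
rewrite -ler_pdivrMr ?norm2_gt0 //.
have Nx : 0 <= (norm2 x)^-1 by rewrite invr_ge0 norm2_ge0.
rewrite mulrC -[X in X * _](ger0_norm Nx) -norm2Z scalemxAr.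
by apply: spectral_norm_ge; rewrite norm2Z ger0_norm // mulVf // norm2_eq0.
Qed.

(** * Minimal-norm solutions *)

Lemma trmx_mulmx_eq0 (R : realType) k l (M : 'M[R]_(k, l)) :
  M^T *m M = 0 -> M = 0.
Proof.
move=> M0; apply/matrixP => i j; rewrite [RHS]mxE.
suff /colP/(_ i) : col j M = 0 by rewrite !mxE.
apply/eqP; rewrite -norm2_eq0 -sqrf_eq0 sqr_norm2_mulmx.
by rewrite colE trmx_mul -mulmxA (mulmxA M^T) M0 mul0mx mulmx0 mxE.
Qed.

(** Among the solutions [x] of [A x = A v] there is one in the row space of [A]
    (the one of minimal norm): over an ordered field [A A^T] and [A] have the
    same left kernel, because [A^T N] vanishes as soon as its Gram matrix does. *)
Lemma normal_equation (R : realType) k l (A : 'M[R]_(k, l)) (v : 'cV[R]_l) :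
  exists u : 'cV[R]_k, A *m (A^T *m u) = A *m v.
Proof.
have /submxP[u uE] : (v^T *m A^T <= A *m A^T)%MS.
  set N := cokermx (A *m A^T).
  have AN : A^T *m N = 0.
    apply: trmx_mulmx_eq0.
    by rewrite trmx_mul trmxK -mulmxA (mulmxA A) mulmx_coker mulmx0.
  by rewrite submxE -mulmxA AN mulmx0.
exists u^T; apply: trmx_inj.
by rewrite !trmx_mul !trmxK -!mulmxA -uE.
Qed.

(** * Basic solutions from pivoted QR *)

(** The part of the factorization that governs [v]: [A P] is [Q] times an upper
    block triangular matrix with invertible first diagonal block [R1].  The
    vector [bt] is eliminated as [R1 vs], which makes [b] explicit. *)
Lemma pivoted_qr_blocks (R : realType) (k l s l2 : nat) (A : 'M[R]_(k, l))
    (b : 'cV[R]_k) (R1 : 'M[R]_s) (R2 : 'M[R]_(s, l2)) (v : 'cV[R]_l) :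
  pivoted_qr A b R1 R2 v ->
  R1 \in unitmx /\
  exists (k2 : nat) (ek : (s + k2 = k)%N) (el : (s + l2 = l)%N)
    (sigma : 'S_l) (Q : 'M[R]_k) (T : 'M[R]_(k2, l2)) (vs : 'cV[R]_s),
  [/\ Q^T *m Q = 1%:M,
      A *m perm_mx sigma = Q *m castmx (ek, el) (block_mx R1 R2 0 T),
      b = Q *m castmx (ek, erefl) (col_mx (R1 *m vs) 0) &
      v = perm_mx sigma *m castmx (el, erefl) (col_mx vs 0)].
Proof.
case=> sigma Q r k1 l1 A1 A2 _ _ k2 T bt vs ek el QQ _ _ _ _ _ Qb _ R1u AP R1vs ->.
split=> //; exists k2, ek, el, sigma, Q, T, vs; split=> //.
by rewrite R1vs -Qb mulmxA (mulmx1C QQ) mul1mx.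
Qed.

Lemma pivoted_qr_solution (R : realType) (k l s l2 : nat) (A : 'M[R]_(k, l))
    (b : 'cV[R]_k) (R1 : 'M[R]_s) (R2 : 'M[R]_(s, l2)) (v : 'cV[R]_l) :
  pivoted_qr A b R1 R2 v -> A *m v = b.
Proof.
move=> /pivoted_qr_blocks [_ [k2 [ek [el [sigma [Q [T [vs]]]]]]]].
subst k l => -[_ AP -> ->]; rewrite !castmx_id in AP *.
by rewrite mulmxA AP -mulmxA mul_block_col !mulmx0 mul0mx !addr0.
Qed.

(** At most [s] entries of [v] are nonzero, since [v] is a permutation of
    [vs; 0]; and [R1] is obtained from [A] by multiplications on both sides, so
    the rank of [A] is at least that of [R1], which is [s]. *)
Lemma pivoted_qr_support (R : realType) (k l s l2 : nat) (A : 'M[R]_(k, l))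
    (b : 'cV[R]_k) (R1 : 'M[R]_s) (R2 : 'M[R]_(s, l2)) (v : 'cV[R]_l) :
  pivoted_qr A b R1 R2 v -> (#|[set j | v j 0%R != 0%R]%SET| <= \rank A)%N.
Proof.
move=> /pivoted_qr_blocks [R1u [k2 [ek [el [sigma [Q [T [vs]]]]]]]].
subst k l => -[QQ AP _ ->]; rewrite !castmx_id in AP *.
apply: (@leq_trans s).
  rewrite -row_permE -[X in (_ <= X)%N]card_ord -(card_imset _ (@lshift_inj s l2)).
  rewrite -(card_imset _ (@perm_inj _ sigma)); apply: subset_leq_card.
  apply/fintype.subsetP => _ /imsetP [j + ->]; rewrite inE mxE => vj.
  case: (splitP (sigma j)) vj => [i ij|i ij].
    have -> : sigma j = lshift l2 i by exact: val_inj.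
    by move=> _; rewrite imset_f.
  have -> : sigma j = rshift s i by exact: val_inj.
  by rewrite col_mxEd mxE eqxx.
have R1E : R1 = row_mx 1%:M 0 *m Q^T *m A *m (perm_mx sigma *m col_mx 1%:M 0).
  rewrite -!mulmxA (mulmxA A) AP -mulmxA (mulmxA Q^T) QQ mul1mx.
  by rewrite mul_block_col mul_row_col !mulmx1 mul1mx !mulmx0 !addr0 mul0mx addr0.
have {1}<- : \rank R1 = s by exact: mxrank_unit.
rewrite R1E; exact: leq_trans (mxrankM_maxl _ _) (mxrankM_maxr _ _).
Qed.

(** Every solution is, after the permutation, of the form [x1; x2] with
    [R1 x1 + R2 x2 = R1 vs]; this expresses the basic solution [vs] through
    [x1] and [x2], at the cost of the factor [R1^-1 R2] on [x2]. *)
Lemma pivoted_qr_near_minimal (R : realType) (k l s l2 : nat)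
    (A : 'M[R]_(k, l)) (b : 'cV[R]_k) (R1 : 'M[R]_s) (R2 : 'M[R]_(s, l2))
    (v v' : 'cV[R]_l) :
  pivoted_qr A b R1 R2 v -> A *m v' = b ->
  norm2 v <= Num.sqrt (1 + spectral_norm (invmx R1 *m R2) ^+ 2) * norm2 v'.
Proof.
move=> /pivoted_qr_blocks [R1u [k2 [ek [el [sigma [Q [T [vs]]]]]]]].
subst k l => -[QQ AP -> ->]; rewrite !castmx_id in AP * => Av'.
set S := spectral_norm _.
have [x v'E] : exists x, v' = perm_mx sigma *m x.
  exists (perm_mx sigma^-1 *m v').
  by rewrite mulmxA -perm_mxM mulgV perm_mx1 mul1mx.
subst v'; have {Av'} : block_mx R1 R2 0 T *m x = col_mx (R1 *m vs) 0.
  have := congr1 (mulmx Q^T) Av'.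
  by rewrite (mulmxA A) AP !mulmxA QQ !mul1mx.
rewrite !norm2_perm_mx -[x]vsubmxK mul_block_col.
move: (usubmx x) (dsubmx x) => x1 x2 /eq_col_mx [R1vs _].
have -> : vs = x1 + invmx R1 *m R2 *m x2.
  by rewrite -[LHS](mulKmx R1u) -R1vs mulmxDr mulKmx // mulmxA.
have -> : norm2 (col_mx (x1 + invmx R1 *m R2 *m x2) (0 : 'cV_l2)) =
          norm2 (x1 + invmx R1 *m R2 *m x2).
  apply/eqP; rewrite -(eqrXn2 (ltn0Sn 1)) ?norm2_ge0 // sqr_norm2_col_mx.
  by rewrite norm20 expr0n addr0.
have S0 : 0 <= S := spectral_norm_ge0 _.
apply: le_trans (norm2D _ _) _.
apply: (@le_trans _ _ (norm2 x1 + S * norm2 x2)).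
  by rewrite lerD2l; exact: spectral_normP.
rewrite -ler_sqr ?nnegrE ?addr_ge0 ?mulr_ge0 ?norm2_ge0 ?sqrtr_ge0 //.
rewrite exprMn sqr_sqrtr ?addr_ge0 ?sqr_ge0 // sqr_norm2_col_mx.
move: (norm2 x1) (norm2 x2) => a c; rewrite -subr_ge0.
(* Cauchy-Schwarz for the vectors (1, S) and (a, c). *)
have -> : (1 + S ^+ 2) * (a ^+ 2 + c ^+ 2) - (a + S * c) ^+ 2 =
          (S * a - c) ^+ 2 by ring.
exact: sqr_ge0.
Qed.

(** * Polynomials and exact weights *)

Lemma pevalE_sum (R : realType) d (I : finType) (a : I -> R)
    (p : I -> {mpoly R[d]}) x :
  peval (\sum_i a i *: p i) x = \sum_i a i * peval (p i) x.
Proof.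
by rewrite /peval raddf_sum /=; apply: eq_bigr => i _; rewrite mevalZ.
Qed.

Lemma diffop_sum (R : realType) (d kappa : nat)
    (c : 'X_{1..d} -> 'cV[R]_d -> R) (I : finType) (a : I -> R)
    (p : I -> {mpoly R[d]}) x :
  diffop kappa c (\sum_i a i *: p i) x = \sum_i a i * diffop kappa c (p i) x.
Proof.
rewrite /diffop; under [RHS]eq_bigr do rewrite mulr_sumr.
rewrite exchange_big; apply: eq_bigr => alpha _ /=.
rewrite raddf_sum /= /peval raddf_sum mulr_sumr /=.
by apply: eq_bigr => i _; rewrite mderivmZ mevalZ mulrCA.
Qed.

Lemma diffop1 (R : realType) (d kappa : nat)
    (c : 'X_{1..d} -> 'cV[R]_d -> R) x :
  diffop kappa c 1 x = c 0%MM x.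
Proof.
have alpha0 : (mdeg (0%MM : 'X_{1..d}) < kappa.+1)%N by rewrite mdeg0.
rewrite /diffop (bigD1 (BMultinom alpha0)) //= mderivm0m /peval meval1 mulr1.
rewrite big1 ?addr0 // => alpha alpha_neq0.
have [i alpha_i] : exists i, alpha i != 0%N.
  apply/existsP; apply: contraNT alpha_neq0 => /existsPn alphai0.
  by apply/eqP/val_inj/mnmP => i /=; rewrite mnm0E; apply/eqP/negPn.
rewrite -mpolyX0 mderivmX mevalZ (bigD1 i) //= mnm0E ffact_small ?lt0n //.
by rewrite mul0n mul0r mulr0.
Qed.

Lemma Pi_sum (R : realType) (d q : nat) (I : finType) (a : I -> R)
    (p : I -> {mpoly R[d]}) :
  (forall i, Pi q (p i)) -> Pi q (\sum_i a i *: p i).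
Proof.
move=> pq; apply: big_ind => [|f g fq gq|i _]; rewrite /Pi /=.
- by rewrite msize0.
- by apply: leq_trans (msizeD_le _ _) _; rewrite geq_max fq gq.
- exact: leq_trans (msizeZ_le _ _) (pq i).
Qed.

Lemma exact_of_basis (R : realType) (d q kappa m n : nat)
    (c : 'X_{1..d} -> 'cV[R]_d -> R) (z : 'cV[R]_d) (y : 'I_m -> 'cV[R]_d)
    (p : 'I_n -> {mpoly R[d]}) (w : 'cV[R]_m) :
  is_basis_Pi q p -> colloc p y *m w = rhs kappa c z p ->
  exact_weights q kappa c z y w.
Proof.
case=> _ _ spanning /colP pw f /spanning [a ->]; rewrite diffop_sum.
under [RHS]eq_bigr do rewrite pevalE_sum mulr_sumr.
rewrite exchange_big; apply: eq_bigr => i _ /=.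
have := pw i; rewrite !mxE => <-; rewrite mulr_sumr.
by apply: eq_bigr => j _; rewrite mxE; ring.
Qed.

Lemma colloc_exact (R : realType) (d q kappa m n : nat)
    (c : 'X_{1..d} -> 'cV[R]_d -> R) (z : 'cV[R]_d) (y : 'I_m -> 'cV[R]_d)
    (p : 'I_n -> {mpoly R[d]}) (w : 'cV[R]_m) :
  (forall i, Pi q (p i)) -> exact_weights q kappa c z y w ->
  colloc p y *m w = rhs kappa c z p.
Proof.
move=> pq ew; apply/colP => i; rewrite !mxE (ew _ (pq i)).
by apply: eq_bigr => j _; rewrite mxE mulrC.
Qed.

Lemma wnorm_Theta (R : realType) (d q m : nat) (z : 'cV[R]_d)
    (y : 'I_m -> 'cV[R]_d) (v : 'cV[R]_m) :
  (forall j, y j != z) -> wnorm q z y (Theta q z y *m v) = norm2 v.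
Proof.
move=> yz; rewrite /wnorm /norm2; congr Num.sqrt; apply: eq_bigr => j _.
rewrite mul_diag_mx !mxE exprMn mulnC exprM mulrAC -exprMn mulVf ?expr1n ?mul1r //.
by rewrite expf_neq0 // norm2_eq0 subr_eq0.
Qed.

Lemma Theta_surj (R : realType) (d q m : nat) (z : 'cV[R]_d)
    (y : 'I_m -> 'cV[R]_d) (w : 'cV[R]_m) :
  (forall j, y j != z) -> exists v, w = Theta q z y *m v.
Proof.
move=> yz; exists (\col_j (norm2 (y j - z) ^+ q * w j 0)); apply/colP => j.
rewrite mul_diag_mx !mxE mulKf //.
by rewrite expf_neq0 // norm2_eq0 subr_eq0.
Qed.

(** * Bounds for the growth function *)

(** Exactness turns [D f(z)] into a sum over the points with nonzero weight,
    where [f] is controlled; Cauchy-Schwarz against the indicator of these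
    points yields the factor [sqrt n]. *)
Lemma growth_le_wnorm (R : realType) (d q kappa m : nat)
    (c : 'X_{1..d} -> 'cV[R]_d -> R) (z : 'cV[R]_d) (y : 'I_m -> 'cV[R]_d)
    (w : 'cV[R]_m) :
  exact_weights q kappa c z y w ->
  (growth q kappa c z [set y j | j in [set j | w j 0%R != 0%R]]
     <= (Num.sqrt #|[set j | w j 0 != 0]%SET|%:R * wnorm q z y w)%R%:E)%E.
Proof.
move=> ew; apply: ge_ereal_sup => _ [f [fq fX] <-]; rewrite lee_fin ew //.
apply: (@le_trans _ _
  (\sum_j (w j 0 != 0)%:R * (`|w j 0| * norm2 (y j - z) ^+ q))).
  apply: ler_sum => j _; have [->|wj] := eqVneq (w j 0) 0.
    by rewrite !mul0r.
  rewrite mul1r; apply: le_trans (ler_norm _) _; rewrite normrM.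
  by apply: ler_wpM2l => //; apply: fX; exists j.
apply: le_trans (ler_norm _) _; rewrite -sqrtr_sqr -sqrtrM //.
apply: ler_wsqrtr; apply: le_trans (cauchy_schwarz_sum _ _) _.
apply: ler_pM; do ?[by apply: sumr_ge0 => j _; exact: sqr_ge0].
  rewrite -sum1_card natr_sum [leRHS]big_mkcond /= ler_sum // => j _.
  by rewrite inE; case: ifP => _; rewrite ?expr1n ?expr0n.
apply: ler_sum => j _.
by rewrite exprMn real_normK ?num_real // mulnC exprM.
Qed.

(** The vector [v'] is the minimal-norm solution [A^T u].  Its multipliers [u]
    are the coefficients of a polynomial that, divided by [norm2 v'], is
    admissible and on which [D] attains [norm2 v'] at [z].  The set [X] may
    contain points outside the range of [y] where the [p i] vanish; this is how
    [z] itself enters when it is one of the points. *)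
Lemma min_norm_le_growth (R : realType) (d q kappa k l : nat)
    (c : 'X_{1..d} -> 'cV[R]_d -> R) (z : 'cV[R]_d)
    (p : 'I_k -> {mpoly R[d]}) (y : 'I_l -> 'cV[R]_d) (X : set 'cV[R]_d)
    (v : 'cV[R]_l) :
  (forall i, Pi q (p i)) -> (forall j, y j != z) ->
  (forall x, X x -> range y x \/ forall i, peval (p i) x = 0) ->
  colloc p y *m Theta q z y *m v = rhs kappa c z p ->
  exists v' : 'cV[R]_l,
    colloc p y *m Theta q z y *m v' = rhs kappa c z p /\
    ((norm2 v')%:E <= growth q kappa c z X)%E.
Proof.
move=> pq yz pX pv; have [u] := normal_equation (colloc p y *m Theta q z y) v.
rewrite pv; set v' := _^T *m u => pv'; exists v'; split=> //.
pose f := \sum_i u i 0 *: p i.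
have v'E j : v' j 0 = norm2 (y j - z) ^- q * peval f (y j).
  rewrite mxE pevalE_sum mulr_sumr; apply: eq_bigr => i _.
  rewrite mxE mul_mx_diag !mxE; ring.
have fz : diffop kappa c f z = norm2 v' ^+ 2.
  rewrite sqr_norm2_mulmx {1}/v' trmx_mul trmxK -mulmxA pv' diffop_sum mxE.
  by apply: eq_bigr => i _; rewrite !mxE.
(* If [norm2 v'] is 0 the scaled polynomial is 0, as [0^-1 = 0], and [D]
   still sends it to [norm2 v'] at [z]. *)
have gE : (norm2 v')^-1 *: f = \sum_i ((norm2 v')^-1 * u i 0) *: p i.
  by rewrite scaler_sumr; apply: eq_bigr => i _; rewrite scalerA.
apply: ereal_sup_ubound; exists ((norm2 v')^-1 *: f); last first.
  congr EFin; rewrite gE diffop_sum.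
  under eq_bigr do rewrite -mulrA.
  rewrite -mulr_sumr -diffop_sum fz expr2 mulrA.
  by have [->|v0] := eqVneq (norm2 v') 0; rewrite ?mulr0 // mulVf // mul1r.
split; first by rewrite gE; exact: Pi_sum.
move=> x /pX [[j _ <-]|px]; last first.
  rewrite gE pevalE_sum big1 ?normr0 ?exprn_ge0 ?norm2_ge0 // => i _.
  by rewrite px mulr0.
have yz0 : norm2 (y j - z) ^+ q != 0.
  by rewrite expf_neq0 // norm2_eq0 subr_eq0.
have -> : peval ((norm2 v')^-1 *: f) (y j) =
          (norm2 v')^-1 * v' j 0 * norm2 (y j - z) ^+ q.
  by rewrite /peval mevalZ v'E -mulrA; congr (_ * _); rewrite mulrAC mulVf // mul1r.
rewrite normrM (ger0_norm (exprn_ge0 _ (norm2_ge0 _))).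
rewrite ler_piMl ?exprn_ge0 ?norm2_ge0 // normrM normfV (ger0_norm (norm2_ge0 _)).
have [->|v0] := eqVneq (norm2 v') 0; first by rewrite invr0 mul0r ler01.
rewrite mulrC ler_pdivrMr ?mul1r ?entry_le_norm2 //.
by rewrite lt0r v0 norm2_ge0.
Qed.

(** Common form of the two cases of the construction: [p'] and [y'] are the
    polynomials and points of the scaled system to which the factorization is
    applied. *)
Lemma qr_near_optimal (R : realType) (d q kappa m k l s l2 : nat)
    (c : 'X_{1..d} -> 'cV[R]_d -> R) (z : 'cV[R]_d)
    (y : 'I_m -> 'cV[R]_d) (w : 'cV[R]_m)
    (p' : 'I_k -> {mpoly R[d]}) (y' : 'I_l -> 'cV[R]_d)
    (R1 : 'M[R]_s) (R2 : 'M[R]_(s, l2)) (v : 'cV[R]_l) :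
  let gamma := Num.sqrt (1 + spectral_norm (invmx R1 *m R2) ^+ 2) in
  (forall i, Pi q (p' i)) -> (forall j, y' j != z) ->
  (forall x, range y x -> range y' x \/ forall i, peval (p' i) x = 0) ->
  pivoted_qr (colloc p' y' *m Theta q z y') (rhs kappa c z p') R1 R2 v ->
  exact_weights q kappa c z y w -> wnorm q z y w = norm2 v ->
  (forall w', exact_weights q kappa c z y w' -> exists v' : 'cV[R]_l,
     norm2 v' = wnorm q z y w' /\
     colloc p' y' *m Theta q z y' *m v' = rhs kappa c z p') ->
  (forall w', exact_weights q kappa c z y w' ->
     wnorm q z y w <= gamma * wnorm q z y w') /\
  (growth q kappa c z [set y j | j in [set j | w j 0%R != 0%R]]
     <= (Num.sqrt #|[set j | w j 0 != 0]%SET|%:R * gamma)%R%:E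
        * growth q kappa c z (range y))%E.
Proof.
move=> gamma p'Pi y'z p'Y qr ew wv exact_scaled; split.
  move=> w' /exact_scaled [v' [<- v'b]]; rewrite wv.
  exact: pivoted_qr_near_minimal qr v'b.
have [v' [v'b v'Y]] := min_norm_le_growth p'Pi y'z p'Y (pivoted_qr_solution qr).
apply: le_trans (growth_le_wnorm ew) _.
set n := #|_|.
apply: le_trans (_ : ((Num.sqrt n%:R * gamma) * norm2 v')%:E <= _)%E.
  rewrite lee_fin -mulrA ler_wpM2l ?sqrtr_ge0 // wv.
  exact: pivoted_qr_near_minimal qr v'b.
by rewrite EFinM lee_wpmul2l ?lee_fin ?mulr_ge0 ?sqrtr_ge0.
Qed.

(** * The case where z is the first point *)

Lemma col_mx_ord0 (R : realType) m (a : R) (w : 'cV[R]_m) :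
  (col_mx a%:M w : 'cV_m.+1) ord0 0 = a.
Proof.
have -> : ord0 = lshift m (0 : 'I_1) by exact: val_inj.
by rewrite (@col_mxEu _ 1 m 1 a%:M w 0 0) mxE.
Qed.

Lemma col_mx_lift0 (R : realType) m (a : R) (w : 'cV[R]_m) (j : 'I_m) :
  (col_mx a%:M w : 'cV_m.+1) (lift ord0 j) 0 = w j 0.
Proof.
have -> : lift ord0 j = rshift 1 j by exact: val_inj.
exact: (@col_mxEd _ 1 m 1 a%:M w j 0).
Qed.

(** The first point coincides with [z], so its weight has the factor
    [0 ^+ (2 * q)] and does not contribute to the weighted norm. *)
Lemma wnorm_lift (R : realType) (d q m : nat) (z : 'cV[R]_d)
    (y : 'I_m.+1 -> 'cV[R]_d) (w : 'cV[R]_m.+1) :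
  (0 < q)%N -> z = y ord0 ->
  wnorm q z y w = wnorm q z (y \o lift ord0) (\col_j w (lift ord0 j) 0).
Proof.
move=> q0 zy; rewrite /wnorm; congr Num.sqrt; rewrite big_ord_recl -zy subrr.
rewrite norm20 expr0n muln_eq0 (gtn_eqF q0) mulr0 add0r.
by apply: eq_bigr => j _; rewrite mxE.
Qed.

(** Polynomials vanishing at [z] do not see the weight of the point [z], so for
    them the exactness conditions only involve the other points. *)
Lemma colloc_lift_mul (R : realType) (d n m : nat) (z : 'cV[R]_d)
    (y : 'I_m.+1 -> 'cV[R]_d) (p : 'I_n -> {mpoly R[d]}) (w : 'cV[R]_m.+1) :
  z = y ord0 -> (forall i, peval (p i) z = 0) ->
  colloc p y *m w = colloc p (y \o lift ord0) *m (\col_j w (lift ord0 j) 0).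
Proof.
move=> zy pz; apply/colP => i; rewrite !mxE big_ord_recl mxE -zy pz mul0r add0r.
by apply: eq_bigr => j _; rewrite !mxE.
Qed.

(** Isolates the constant polynomial and the point [z]: the remaining
    polynomials vanish at [z], which leaves zeros below the corner. *)
Lemma colloc_bordered (R : realType) (d n m : nat) (z : 'cV[R]_d)
    (y : 'I_m.+1 -> 'cV[R]_d) (p : 'I_n.+1 -> {mpoly R[d]}) :
  z = y ord0 -> p ord0 = 1 -> (forall i, peval (p (lift ord0 i)) z = 0) ->
  colloc p y = block_mx (1%:M : 'M[R]_1) (const_mx 1) 0
                        (colloc (p \o lift ord0) (y \o lift ord0)).
Proof.
move=> zy p0 pz.
have l0 k (i : 'I_1) : lshift k i = ord0 :> 'I_(1 + k) by rewrite ord1; exact: val_inj.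
have r1 k (i : 'I_k) : rshift 1 i = lift ord0 i :> 'I_(1 + k) by exact: val_inj.
apply: etrans (esym (@submxK _ 1 n 1 m _)) _.
congr block_mx; apply/matrixP => i j.
- by rewrite !mxE !l0 p0 /peval meval1 !ord1.
- by rewrite !mxE l0 p0 /peval meval1.
- by rewrite !mxE l0 r1 -zy pz.
- by rewrite !mxE !r1.
Qed.

(** The bordered matrix is the block diagonal matrix of 1 and [A], times a
    unipotent matrix. *)
Lemma rank_border (R : realType) k l (b : 'rV[R]_l) (A : 'M[R]_(k, l)) :
  \rank (block_mx (1%:M : 'M[R]_1) b 0 A) = (\rank A).+1.
Proof.
have -> : block_mx (1%:M : 'M[R]_1) b 0 A =
          block_mx 1%:M 0 0 A *m block_mx 1%:M b 0 1%:M.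
  by rewrite mulmx_block !mulmx0 !mul0mx !mul1mx !mulmx1 !addr0 add0r.
rewrite mxrankMfree ?rank_diag_block_mx ?mxrank1 //.
by rewrite row_free_unit unitmxE det_ublock !det1 mulr1 unitr1.
Qed.

(** * Near-optimality of the pivoted QR weights *)

Lemma card_image_finset (T : finType) (U : Type) (f : T -> U) (S : {set T}) :
  injective f -> ([set f x | x in [set x | x \in S]] #= `I_#|S|)%card.
Proof.
move=> f_inj; have [->|[x0 _]] := set_0Vmem S.
  have -> : [set f x | x in [set x | x \in finset.set0]] = set0.
    by apply/seteqP; split=> // u [x /=]; rewrite inE.
  by rewrite cards0 II0 card_eq00.
have -> : [set f x | x in [set x | x \in S]] =
          [set f (nth x0 (enum S) k) | k in `I_#|S|].
  apply/seteqP; split=> _ [x /= xS <-].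
    exists (index x (enum S)); last by rewrite nth_index // mem_enum.
    by rewrite /= cardE index_mem mem_enum.
  exists (nth x0 (enum S) x) => //=.
  by rewrite -mem_enum mem_nth // -cardE.
apply: inj_card_eq => h k; rewrite !in_setE /= cardE => hS kS /f_inj /eqP.
by rewrite nth_uniq ?enum_uniq // => /eqP.
Qed.

Theorem theorem1 (R : realType) (d q m kappa nu : nat)
    (z : 'cV[R]_d) (y : 'I_m.+1 -> 'cV[R]_d)
    (c : 'X_{1..d} -> 'cV[R]_d -> R)
    (p : 'I_nu.+1 -> {mpoly R[d]})
    (s l2 : nat) (R1 : 'M[R]_s) (R2 : 'M[R]_(s, l2)) (w : 'cV[R]_m.+1)
    (d_gt0 : (0 < d)%N) (q_gt0 : (0 < q)%N)
    (y_inj : injective y)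
    (z_neq : forall j : 'I_m, z != y (lift ord0 j))
    (growth_fin : (growth q kappa c z (range y) < +oo)%E)
    (nuE : nu.+1 = 'C(q.-1 + d, d))
    (p_basis : is_basis_Pi q p)
    (p_at_z : z = y ord0 ->
       p ord0 = 1 /\ forall i : 'I_nu, peval (p (lift ord0 i)) z = 0)
    (w_qr : qr_weights q kappa c z y p R1 R2 w) :
  let gamma := Num.sqrt (1 + spectral_norm (invmx R1 *m R2) ^+ 2) in
  let Y := range y in
  let Ycirc := [set y j | j in [set j | w j 0 != 0]] in
  let n := #|[set j | w j 0 != 0]%SET| in
  [/\ forall wmin : 'cV[R]_m.+1, l2_minimal q kappa c z y wmin ->
        wnorm q z y w <= gamma * wnorm q z y wmin,
      (growth q kappa c z Ycirc
         <= (Num.sqrt n%:R * gamma)%:E * growth q kappa c z Y)%E,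
      (Ycirc #= `I_n)%card &
      (n <= \rank (colloc p y))%N].
Proof.
move=> gamma Y Ycirc n.
have cardY : (Ycirc #= `I_n)%card.
  rewrite (_ : Ycirc = [set y j | j in [set j | j \in [set j | w j 0 != 0]%SET]]).
    exact: card_image_finset.
  by congr image; apply/funext => j; rewrite /= inE.
have [pPi _ _] := p_basis.
have conclude :
    (forall w', exact_weights q kappa c z y w' ->
       wnorm q z y w <= gamma * wnorm q z y w') /\
    (growth q kappa c z Ycirc
       <= (Num.sqrt n%:R * gamma)%:E * growth q kappa c z Y)%E ->
    (n <= \rank (colloc p y))%N ->
  [/\ forall wmin : 'cV[R]_m.+1, l2_minimal q kappa c z y wmin ->
        wnorm q z y w <= gamma * wnorm q z y wmin,
      (growth q kappa c z Ycirc
         <= (Num.sqrt n%:R * gamma)%:E * growth q kappa c z Y)%E,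
      (Ycirc #= `I_n)%card &
      (n <= \rank (colloc p y))%N].
  by move=> [w_le growth_le] n_le; split=> // wmin [/w_le].
case: w_qr => [v z_neq0 qr wE|v wt zy0 qr wtE wE].
  have yz j : y j != z.
    by rewrite eq_sym; case: (unliftP ord0 j) => [j' ->|->].
  apply: conclude.
    apply: (qr_near_optimal pPi yz _ qr); first by left.
    - apply: exact_of_basis p_basis _.
      by rewrite wE mulmxA; exact: pivoted_qr_solution qr.
    - by rewrite wE wnorm_Theta.
    move=> w' ew'; have [v' w'E] := Theta_surj q w' yz.
    exists v'; rewrite w'E wnorm_Theta //; split=> //.
    by rewrite -mulmxA -w'E; exact: colloc_exact ew'.
  apply: (@leq_trans #|[set j | v j 0 != 0]%SET|).
    apply: subset_leq_card; apply/fintype.subsetP => j; rewrite !inE wE.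
    by apply: contraNN => /eqP vj; rewrite mul_diag_mx mxE vj mulr0.
  exact: leq_trans (pivoted_qr_support qr) (mxrankM_maxl _ _).
have [p0 pz] := p_at_z zy0.
have pPi' i : Pi q ((p \o lift ord0) i) by exact: pPi.
have yz j : (y \o lift ord0) j != z by rewrite eq_sym z_neq.
have pz' i : peval ((p \o lift ord0) i) z = 0 by exact: pz.
have tail_w : \col_j w (lift ord0 j) 0 = wt.
  by apply/colP => j; rewrite mxE wE col_mx_lift0.
apply: conclude.
  apply: (qr_near_optimal pPi' yz _ qr).
  - move=> _ [j _ <-]; case: (unliftP ord0 j) => [j' ->|->].
      by left; exists j'.
    by right=> i; rewrite -zy0.
  - apply: exact_of_basis p_basis _; apply/colP => i.
    case: (unliftP ord0 i) => [i' ->|->].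
      have /colP/(_ i') :
          colloc (p \o lift ord0) y *m w = rhs kappa c z (p \o lift ord0).
        rewrite (colloc_lift_mul _ zy0 pz') tail_w wtE mulmxA.
        exact: pivoted_qr_solution qr.
      by rewrite !mxE => <-; apply: eq_bigr => j _; rewrite !mxE.
    (* The equation for the constant polynomial is sum_j w_j = c_0(z), which
       is what the first weight is chosen to satisfy. *)
    rewrite [RHS]mxE p0 diffop1 mxE big_ord_recl mxE p0 /peval meval1 mul1r.
    have -> : \sum_(j < m) colloc p y ord0 (lift ord0 j) * w (lift ord0 j) 0 =
              \sum_(j < m) wt j 0.
      apply: eq_bigr => j _.
      by rewrite wE col_mx_lift0 mxE p0 /peval meval1 mul1r.
    by rewrite wE col_mx_ord0 subrK.
  - by rewrite (wnorm_lift _ q_gt0 zy0) tail_w wtE wnorm_Theta.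
  move=> w' ew'.
  have [v' w'E] := Theta_surj q (\col_j w' (lift ord0 j) 0) yz.
  exists v'; rewrite (wnorm_lift _ q_gt0 zy0) w'E wnorm_Theta //; split=> //.
  rewrite -mulmxA -w'E -(colloc_lift_mul _ zy0 pz').
  exact: colloc_exact ew'.
rewrite (colloc_bordered zy0 p0 pz) rank_border.
(* The first weight may be nonzero on top of those coming from v; the border
   of the collocation matrix supplies the extra unit of rank. *)
apply: (@leq_trans #|[set j | v j 0 != 0]%SET|.+1).
  rewrite -(card_imset _ (@lift_inj _ ord0)).
  have cardU (S : {set 'I_m.+1}) : (#|ord0 |: S| <= #|S|.+1)%N.
    by rewrite cardsU1; case: (_ \notin _).
  apply: leq_trans (cardU _); apply: subset_leq_card.
  apply/fintype.subsetP => j; rewrite !inE.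
  case: (unliftP ord0 j) => [j' ->|-> //]; rewrite wE col_mx_lift0 => wj.
  apply/orP; right; apply: imset_f; rewrite inE.
  by apply: contraNN wj => /eqP vj; rewrite wtE mul_diag_mx mxE vj mulr0.
rewrite ltnS; exact: leq_trans (pivoted_qr_support qr) (mxrankM_maxl _ _).
Qed.
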